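(* Let $\mathcal X$ be a set, $B>0$, $T\ge 1$, and $\gamma\in(B/T,B)$. Let $\mathcal F$ be a set of functions $\mathcal X\to\mathbb R$ with $\sup_{f\in\mathcal F}\|f\|_\infty\le B$ such that $(\mathcal F,\|\cdot\|_\infty)$ is totally bounded. Let $(x_t)_{t\ge1}$ be any sequence in $\mathcal X$ and $(y_t)_{t\ge 1}$ any real sequence with $\max_{1\le t\le T}|y_t|\le B$. Then the Chaining Exponentially Weighted Average forecaster (described in the context), tuned with $\eta^{(0)}=1/(50B^2)$ and $\eta^{(k)}=\sqrt{2\log(N_k)/T}\,2^k/(30B\gamma)$ for $k=1,\ldots,K$, satisfies $$\sum_{t=1}^T(y_t-\hat y_t)^2-\inf_{f\in\mathcal F}\sum_{t=1}^T(y_t-f(x_t))^2\le B^2\big(5+50\log\mathcal N_\infty(\mathcal F,\gamma)\big)+120B\sqrt T\int_0^{\gamma/2}\sqrt{\log\mathcal N_\infty(\mathcal F,\epsilon)}\,d\epsilon.$$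
   Context: Online protocol: at each round $t$, $x_t$ is revealed, the forecaster outputs $\hat y_t\in\mathbb R$, then $y_t$ is revealed. $\|f\|_\infty=\sup_{x\in\mathcal X}|f(x)|$. A proper $\epsilon$-net of $\mathcal F$ is a subset $\mathcal G\subseteq\mathcal F$ such that every $f\in\mathcal F$ has some $g\in\mathcal G$ with $\|f-g\|_\infty\le\epsilon$; $\mathcal N_\infty(\mathcal F,\epsilon)$ is the smallest cardinality of a proper $\epsilon$-net; totally bounded means this is finite for all $\epsilon>0$. Construction: set $K=\lceil\log_2(\gamma T/B)\rceil$. For each $k\ge 0$, let $\mathcal F^{(k)}$ be a proper $\gamma/2^k$-net of $\mathcal F$ of cardinality $\mathcal N_\infty(\mathcal F,\gamma/2^k)$, and for $f\in\mathcal F$ let $\pi_k(f)\in\arg\min_{h\in\mathcal F^{(k)}}\|f-h\|_\infty$. Write $\mathcal F^{(0)}=\{f^{(0)}_1,\ldots,f^{(0)}_{N_0}\}$ and, for $k\ge1$, $\mathcal G^{(k)}=\{\pi_k(f)-\pi_{k-1}(f):f\in\mathcal F\}=\{g^{(k)}_1,\ldots,g^{(k)}_{N_k}\}$. Algorithm: initialize $\hat{\boldsymbol w}_1$ uniform on $\{1,\ldots,N_0\}$ and $\hat{\boldsymbol u}^{(j,k)}_1$ uniform on $\{1,\ldots,N_k\}$ for all $j\le N_0$, $k\le K$. At round $t$: define $\hat f_{t,j}=f^{(0)}_j+\sum_{k=1}^K\sum_{i=1}^{N_k}\hat u^{(j,k)}_{t,i}g^{(k)}_i$; predict $\hat y_t=\sum_{j=1}^{N_0}\hat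 w_{t,j}\hat f_{t,j}(x_t)$; after observing $y_t$, update $$\hat u^{(j,k)}_{t+1,i}\propto\exp\Big(-\eta^{(k)}\sum_{s=1}^t-2\big(y_s-\hat f_{s,j}(x_s)\big)g^{(k)}_i(x_s)\Big),\qquad \hat w_{t+1,j}\propto\exp\Big(-\eta^{(0)}\sum_{s=1}^t\big(y_s-\hat f_{s,j}(x_s)\big)^2\Big),$$ normalized to sum to one over $i\in\{1,\ldots,N_k\}$ and over $j\in\{1,\ldots,N_0\}$ respectively. *)

(* Defs.v *)
From HB Require Import structures.
From mathcomp Require Import all_boot all_order all_algebra.
From mathcomp Require Import all_classical all_reals all_analysis.
Unset Printing Implicit Defensive.
Import Order.TTheory GRing.Theory Num.Theory.
Import numFieldNormedType.Exports.
Local Open Scope classical_set_scope.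
Local Open Scope ring_scope.

Section Defs.
Context {R : realType} {X : Type}.

Definition supnorm (f : X -> R) : \bar R :=
  ereal_sup [set (`|f x|)%:E | x in [set: X]].

Definition is_proper_net (F : set (X -> R)) (e : R) {n : nat}
  (h : 'I_n -> X -> R) : Prop :=
  (forall i, F (h i)) /\
  (forall f, F f -> exists i, (supnorm (fun x => (f x - h i x)%R) <= e%:E)%E).

Definition has_net (F : set (X -> R)) (e : R) (n : nat) : Prop :=
  exists h : 'I_n -> X -> R, is_proper_net F e h.

Definition totally_bounded (F : set (X -> R)) : Prop :=
  forall e : R, 0 < e -> exists n, has_net F e n.

(* N_oo(F, e): smallest cardinality of a proper e-net (0 if none is finite) *)
Definition covnum (F : set (X -> R)) (e : R) : nat :=
  match pselect (exists n, has_net F e n) with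
  | left H => ex_minn (P := fun n => `[< has_net F e n >])
                (match H with ex_intro n Hn => ex_intro _ n (asboolT Hn) end)
  | right _ => 0%N
  end.

Definition softmax {n : nat} (eta : R) (L : 'I_n -> R) (i : 'I_n) : R :=
  expR (- (eta * L i)) / \sum_(i' < n) expR (- (eta * L i')).

Section Forecaster.
Variables (N0 : nat) (f0 : 'I_N0 -> X -> R) (Nk : nat -> nat)
  (g : forall k, 'I_(Nk k) -> X -> R) (K : nat) (eta0 : R) (eta : nat -> R)
  (xs : nat -> X) (ys : nat -> R).

Definition fhat_of (U : forall k, 'I_(Nk k) -> R) (j : 'I_N0) : X -> R :=
  fun x => f0 j x + \sum_(1 <= k < K.+1) \sum_(i < Nk k) U k i * @g k i x.

(* cumU t j k i = sum_{s=1}^t -2 (y_s - fhat_{s,j}(x_s)) g^(k)_i(x_s) *)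
Fixpoint cumU (t : nat) : 'I_N0 -> forall k, 'I_(Nk k) -> R :=
  match t with
  | 0%N => fun _ _ _ => 0
  | t'.+1 => let L := cumU t' in
      fun j k i => L j k i
        + (-2) * (ys t'.+1 - fhat_of (fun k' => softmax (eta k') (L j k')) j (xs t'.+1))
               * @g k i (xs t'.+1)
  end.

Definition uhat (t : nat) (j : 'I_N0) (k : nat) : 'I_(Nk k) -> R :=
  softmax (eta k) (cumU t.-1 j k).
Definition fhat (t : nat) (j : 'I_N0) : X -> R := fhat_of (fun k => uhat t j k) j.
Definition cumW (t : nat) (j : 'I_N0) : R :=
  \sum_(1 <= s < t.+1) (ys s - fhat s j (xs s)) ^+ 2.
Definition what (t : nat) : 'I_N0 -> R := softmax eta0 (cumW t.-1).
Definition yhat (t : nat) : R := \sum_(j < N0) what t j * fhat t j (xs t).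

End Forecaster.
End Defs.

(* Main.v *)
(**
  Every increment of [G^(k)] has sup norm at most [3 gamma / 2^k], so all the
  experts' predictions stay within [4 B] and all their residuals within [5 B].
  On that range the square loss is exp-concave with parameter [1 / (50 B^2)],
  so aggregating the [N_0] experts costs [50 B^2 log N_0].  Inside expert [j],
  convexity linearizes the square loss, the regret splits over the levels [k],
  and at each level Hoeffding's lemma with losses bounded by [30 B gamma / 2^k]
  gives [30 B (gamma / 2^k) sqrt (2 T log N_k)].  Since [N_k] is at most the
  square of the covering number at scale [gamma / 2^k], the sum over [k] is a
  lower Riemann sum of the entropy integral.  The last net is [B / T]-close to
  the comparison function, which costs at most [4 B^2] over [T] rounds.
*)
Require Import Defs.
From HB Require Import structures.
From mathcomp Require Import all_boot all_order all_algebra.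
From mathcomp Require Import all_classical all_reals all_analysis.
From mathcomp Require Import measurable_realfun ring lra.
Import Order.TTheory GRing.Theory Num.Theory.
Import numFieldNormedType.Exports.
Local Open Scope classical_set_scope.
Local Open Scope ring_scope.

(** * Exponential inequalities: exp-concavity and Hoeffding's lemma *)

Lemma is_derive_ge0_le (R : realType) (f df : R -> R) (a b : R) : a <= b ->
  (forall x, a <= x <= b -> is_derive x 1 f (df x)) ->
  (forall x, a <= x <= b -> 0 <= df x) -> f a <= f b.
Proof.
move=> ab fdf df0.
have [||c cab fba] := @MVT_segment R f df a b ab.
- move=> x; rewrite in_itv/= => /andP[ax xb].
  by apply: fdf; rewrite !ltW.
- apply: continuous_in_subspaceT => x; rewrite inE/= in_itv/= => xab.
  by apply/differentiable_continuous/derivable1_diffP; have [] := fdf _ xab.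
- rewrite -subr_ge0 fba mulr_ge0 ?subr_ge0//.
  by apply: df0; rewrite in_itv/= in cab.
Qed.

(** The Gaussian exp(-z^2/2) is concave on [-1, 1], hence lies below its tangent at [z0]; both sides
    are then divided by its value at [z0]. *)
Lemma gauss_tangent (R : realType) (z0 z : R) : `|z0| <= 1 -> `|z| <= 1 ->
  expR ((z0 ^+ 2 - z ^+ 2) / 2) <= 1 - z0 * (z - z0).
Proof.
wlog : z0 z / z0 <= z => [hw|].
  have [/hw//|/ltW zz0 h0 h] := leP z0 z.
  have := hw (- z0) (- z); rewrite lerN2 !normrN !sqrrN => /(_ zz0 h0 h).
  by congr (_ <= _); ring.
move=> z0z; rewrite !ler_norml => /andP[h1 h2] /andP[h3 h4].
have pos x : z0 <= x <= z -> 0 < 1 - z0 * (x - z0).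
  by move=> /andP[? ?]; nra.
have c0 : 0 < 1 - z0 * (z - z0) by apply: pos; rewrite z0z lexx.
rewrite -[leRHS]lnK ?posrE ?c0// ler_expR.
(* [psi] is the logarithm of the right side over the left side. It vanishes at [z0], and its
   derivative is written in factored form to show its sign. *)
pose psi x := ln (1 - z0 * (x - z0)) + (x ^+ 2 - z0 ^+ 2) / 2.
pose dpsi x := (x - z0) * (1 - z0 * x) / (1 - z0 * (x - z0)).
suff : psi z0 <= psi z by rewrite /psi !subrr mulr0 mul0r subr0 ln1; lra.
apply: (@is_derive_ge0_le _ psi dpsi _ _ z0z) => x xz; have px := pos _ xz.
  rewrite /psi.
  have d1 : is_derive x 1 (fun x => 1 - z0 * (x - z0)) (- z0).
    by apply: is_derive_eq; rewrite /GRing.scale/=; ring.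
  have d2 := @is_derive1_comp _ (@ln R) _ x _ _ (is_derive1_ln px) d1.
  apply: is_derive_eq.
  by rewrite /GRing.scale/= /dpsi; field; rewrite gt_eqF.
move/andP: xz => [? ?]; rewrite /dpsi; apply: divr_ge0; last exact: ltW.
by apply: mulr_ge0; nra.
Qed.

(** The left side is the moment generating function of a variable with values -1 and 1 and mean
    [mu]. Its logarithm has value 0 and slope [mu] at 0, and second derivative at most 1. *)
Lemma hoeffding_two_point (R : realType) (mu s : R) : `|mu| <= 1 ->
  (1 - mu) / 2 * expR (- s) + (1 + mu) / 2 * expR s
    <= expR (mu * s + s ^+ 2 / 2).
Proof.
wlog : mu s / 0 <= s => [hw hmu|].
  have [s0|/ltW s0] := leP 0 s; first exact: hw.
  have := hw (- mu) (- s); rewrite oppr_ge0 normrN opprK mulrNN sqrrN opprK.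
  by move=> /(_ s0 hmu); rewrite addrC.
move=> s0; rewrite ler_norml => /andP[hm1 hm2].
pose E (x : R) : R := (1 - mu) / 2 * expR (- x) + (1 + mu) / 2 * expR x.
pose E' (x : R) : R := (1 + mu) / 2 * expR x - (1 - mu) / 2 * expR (- x).
have E_gt0 x : 0 < E x.
  by rewrite /E; have := expR_gt0 x; have := expR_gt0 (- x); nra.
have dexpN (x : R) : is_derive x 1 (fun x : R => expR (- x)) (- expR (- x)).
  have dN : is_derive x 1 (fun x : R => - x) (- 1) by apply: is_deriveN.
  by apply: (is_derive_eq (is_derive1_comp (is_derive_expR (- x)) dN)); ring.
have dE (x : R) : is_derive x 1 E (E' x).
  by rewrite /E; apply: is_derive_eq; rewrite /GRing.scale/= /E'; ring.
have dE' (x : R) : is_derive x 1 E' (E x).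
  by rewrite /E'; apply: is_derive_eq; rewrite /GRing.scale/= /E; ring.
have E0 : E 0 = 1 by rewrite /E oppr0 expR0; lra.
have E'0 : E' 0 = mu by rewrite /E' oppr0 expR0; lra.
(* Since [E'] has derivative [E], the quotient E'/E has derivative 1 - (E'/E)^2, so the derivative
   of [q] is a square. *)
have slope x : 0 <= x -> E' x / E x <= mu + x.
  move=> x0; pose q (y : R) := y - E' y / E y.
  suff : q 0 <= q x by rewrite /q E0 E'0; lra.
  apply: (@is_derive_ge0_le _ q (fun y => (E' y / E y) ^+ 2) _ _ x0) => y _.
  - have Ey : E y != 0 by rewrite gt_eqF.
    have dV := @is_deriveV _ E y _ _ Ey (dE y).
    have dq := is_deriveM (dE' y) dV.
    have dq' := is_deriveB (is_derive_id y 1) dq.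
    apply: (is_derive_eq dq').
    by rewrite /GRing.scale/=; field.
  - exact: sqr_ge0.
rewrite -/(E s) -[leLHS]lnK ?posrE ?E_gt0// ler_expR.
pose h (y : R) := mu * y + y ^+ 2 / 2 - ln (E y).
suff : h 0 <= h s by rewrite /h E0 ln1 mulr0 expr0n/= mul0r; lra.
apply: (@is_derive_ge0_le _ h (fun y => mu + y - E' y / E y) _ _ s0) => y /andP[y0 _].
- have dl := @is_derive1_comp _ (@ln R) _ y _ _ (is_derive1_ln (E_gt0 y)) (dE y).
  rewrite /h; apply: is_derive_eq.
  by rewrite /GRing.scale/=; field; rewrite gt_eqF.
- by rewrite subr_ge0; exact: slope.
Qed.

(** By convexity each [expR (s * x i)] lies below the chord of the exponential between - s M and s
    M. The weighted mean of the chords is the two-point case with mean [mu]. *)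
Lemma hoeffding_weighted (R : realType) (n : nat) (w x : 'I_n -> R) (M s : R) :
  0 < M -> (forall i, 0 <= w i) -> \sum_i w i = 1 -> (forall i, `|x i| <= M) ->
  \sum_i w i * expR (s * x i)
    <= expR (s * \sum_i w i * x i + (s * M) ^+ 2 / 2).
Proof.
move=> M0 w0 w1 xM; pose mu := (\sum_i w i * x i) / M.
have mu1 : `|mu| <= 1.
  rewrite normrM normfV [`|M|]gtr0_norm// ler_pdivrMr// mul1r.
  apply: le_trans (ler_norm_sum _ _ _) _.
  rewrite -[leRHS]mul1r -w1 mulr_suml; apply: ler_sum => i _.
  by rewrite normrM ger0_norm// ler_wpM2l.
have -> : s * \sum_i w i * x i + (s * M) ^+ 2 / 2
        = mu * (s * M) + (s * M) ^+ 2 / 2.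
  by rewrite /mu; field; rewrite gt_eqF.
apply: le_trans (hoeffding_two_point _ _ (s * M) mu1).
have -> : (1 - mu) / 2 * expR (- (s * M)) + (1 + mu) / 2 * expR (s * M)
    = \sum_i w i * ((1 - x i / M) / 2 * expR (- (s * M))
                    + (1 + x i / M) / 2 * expR (s * M)).
  transitivity (\sum_i (w i * ((expR (- (s * M)) + expR (s * M)) / 2)
       + (w i * x i) * ((expR (s * M) - expR (- (s * M))) / 2 / M))).
    by rewrite big_split/= -!mulr_suml w1 /mu; ring.
  by apply: eq_bigr => i _; ring.
apply: ler_sum => i _; apply: ler_wpM2l => //.
set u := x i / M.
have -> : s * x i = u * (s * M) by rewrite /u; field; rewrite gt_eqF.
have : `|u| <= 1.
  by rewrite normrM normfV [`|M|]gtr0_norm// ler_pdivrMr// mul1r.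
rewrite ler_norml => /andP[u1 u2]; set r := s * M.
(* The tangent to [expR] at [u * r] lies below it at [- r] and at [r]. *)
have tangent (a : R) : expR (u * r) * (1 + (a - u * r)) <= expR a.
  have -> : expR a = expR (u * r) * expR (a - u * r).
    by rewrite -expRD; congr expR; ring.
  by rewrite ler_wpM2l ?expR_ge0// expR_ge1Dx.
have := tangent (- r); have := tangent r; nra.
Qed.

(** After division by [D] the residuals lie in [-1, 1], where the tangent bound at their mean [z0]
    applies. *)
Lemma expR_sqr_concave (R : realType) (n : nat) (w a : 'I_n -> R) (D y : R) :
  0 < D -> (forall i, 0 <= w i) -> \sum_i w i = 1 ->
  (forall i, `|y - a i| <= D) ->
  \sum_i w i * expR (- (1 / (2 * D ^+ 2) * (y - a i) ^+ 2))
    <= expR (- (1 / (2 * D ^+ 2) * (y - \sum_i w i * a i) ^+ 2)).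
Proof.
move=> D0 w0 w1 yD.
have Dn : D != 0 by rewrite gt_eqF.
pose z i := (y - a i) / D; pose z0 := \sum_i w i * z i.
have z0E : z0 = (y - \sum_i w i * a i) / D.
  rewrite /z0 -[X in X - _]mul1r -w1 mulr_suml -sumrB mulr_suml.
  by apply: eq_bigr => i _; rewrite /z; ring.
have z1 i : `|z i| <= 1.
  by rewrite normrM normfV [`|D|]gtr0_norm// ler_pdivrMr// mul1r.
have z01 : `|z0| <= 1.
  apply: le_trans (ler_norm_sum _ _ _) _; rewrite -w1; apply: ler_sum => i _.
  by rewrite normrM ger0_norm// ler_piMr.
have -> : 1 / (2 * D ^+ 2) * (y - \sum_i w i * a i) ^+ 2 = z0 ^+ 2 / 2.
  by rewrite z0E; field.
(* The linear term of the tangent averages to zero because [z0] is the mean of the [z i]. *)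
have sumE : \sum_i w i * (expR (- (z0 ^+ 2 / 2)) * (1 - z0 * (z i - z0)))
    = expR (- (z0 ^+ 2 / 2)).
  transitivity (\sum_i (w i * (expR (- (z0 ^+ 2 / 2)) * (1 + z0 ^+ 2))
       - (w i * z i) * (expR (- (z0 ^+ 2 / 2)) * z0))).
    by apply: eq_bigr => i _; ring.
  by rewrite sumrB -!mulr_suml w1 -/z0; ring.
rewrite -[leRHS]sumE; apply: ler_sum => i _; apply: ler_wpM2l => //.
have -> : - (1 / (2 * D ^+ 2) * (y - a i) ^+ 2)
    = - (z0 ^+ 2 / 2) + (z0 ^+ 2 - z i ^+ 2) / 2 by rewrite /z; field.
by rewrite expRD ler_wpM2l ?expR_ge0// gauss_tangent.
Qed.

(** * Exponential weights *)

Section softmax.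
Context {R : realType} {n : nat}.
Implicit Types (eta : R) (L : 'I_n -> R).

Lemma softmax_ge0 eta L i : 0 <= softmax eta L i.
Proof. by rewrite /softmax divr_ge0 ?expR_ge0// sumr_ge0// => j _; exact: expR_ge0. Qed.

Lemma sum_expR_gt0 (a : 'I_n -> R) (i : 'I_n) : 0 < \sum_j expR (a j).
Proof.
rewrite (bigD1 i)//= ltr_wpDr ?expR_gt0// sumr_ge0// => j _; exact: expR_ge0.
Qed.

Lemma sum_softmax eta L (i : 'I_n) : \sum_j softmax eta L j = 1.
Proof.
by rewrite /softmax -mulr_suml divff// gt_eqF// (sum_expR_gt0 (fun j => - (eta * L j)) i).
Qed.

(* The potential [\sum_j expR (- (eta * L t j))] is multiplied at each round by
   the left-hand side of the hypothesis. *)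
Lemma exp_weights_regret eta (L : nat -> 'I_n -> R) (m : nat -> R) (T : nat)
    (i : 'I_n) :
  (forall j, L 0%N j = 0) ->
  (forall t, (t < T)%N ->
    \sum_j softmax eta (L t) j * expR (- (eta * (L t.+1 j - L t j)))
      <= expR (- m t.+1)) ->
  \sum_(1 <= t < T.+1) m t <= ln n%:R + eta * L T i.
Proof.
move=> L0 step; pose W t := \sum_j expR (- (eta * L t j)).
have W_gt0 t : 0 < W t by exact: (sum_expR_gt0 (fun j => - (eta * L t j)) i).
have WT t : (t <= T)%N -> W t <= n%:R * expR (- \sum_(1 <= s < t.+1) m s).
  elim: t => [_|t IH tT].
    rewrite big_geq// oppr0 expR0 mulr1 /W.
    under eq_bigr do rewrite L0 mulr0 oppr0 expR0.
    by rewrite sumr_const card_ord.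
  have -> : W t.+1 = W t *
      \sum_j softmax eta (L t) j * expR (- (eta * (L t.+1 j - L t j))).
    rewrite mulr_sumr; apply: eq_bigr => j _; rewrite /softmax -/(W t).
    rewrite mulrA mulrCA divff ?gt_eqF// mulr1 -expRD; congr expR; ring.
  rewrite big_nat_recr//= opprD expRD mulrA.
  apply: ler_pM => //; first exact: ltW.
  - by apply: sumr_ge0 => j _; rewrite mulr_ge0 ?softmax_ge0 ?expR_ge0.
  - exact/IH/ltnW.
  - exact: step.
have n_gt0 : 0 < n%:R :> R by rewrite ltr0n; case: n i {W W_gt0 WT L0 step L} => [[]|].
have Wi : expR (- (eta * L T i)) <= W T.
  rewrite /W (bigD1 i)//= lerDl sumr_ge0// => j _; exact: expR_ge0.
have := le_trans Wi (WT T (leqnn T)).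
by rewrite -[X in _ <= X * _]lnK ?posrE// -expRD ler_expR; lra.
Qed.

End softmax.

(** Hoeffding's lemma bounds the potential ratio of each round. With eta = a / M the two costs ln n
    / eta and T eta M^2 / 2 are equal and add up to M T a. *)
Lemma exp_weights_hoeffding (R : realType) (n : nat) (L : nat -> 'I_n -> R)
    (M : R) (T : nat) (i : 'I_n) :
  0 < M -> (1 <= T)%N -> (forall j, L 0%N j = 0) ->
  (forall t j, (t < T)%N -> `|L t.+1 j - L t j| <= M) ->
  \sum_(1 <= t < T.+1) \sum_j
      softmax (Num.sqrt (2 * ln n%:R / T%:R) / M) (L t.-1) j
      * (L t j - L t.-1 j)
    <= L T i + M * Num.sqrt (2 * T%:R * ln n%:R).
Proof.
move=> M0 T1 L0 LM; set a := Num.sqrt _; set eta := a / M.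
have T0 : 0 < T%:R :> R by rewrite ltr0n.
have n1 : 1 <= n%:R :> R by rewrite ler1n; case: n i {L L0 LM a eta} => [[]|].
have a0 : 0 <= a by exact: sqrtr_ge0.
have a2 : a ^+ 2 = 2 * ln n%:R / T%:R.
  by rewrite sqr_sqrtr// divr_ge0 ?mulr_ge0 ?ln_ge0// ltW.
have lnE : ln n%:R = T%:R * a ^+ 2 / 2 by rewrite a2; field; rewrite gt_eqF.
have -> : Num.sqrt (2 * T%:R * ln n%:R) = T%:R * a.
  have -> : 2 * T%:R * ln n%:R = (T%:R * a) ^+ 2.
    by rewrite exprMn a2; field; rewrite gt_eqF.
  by rewrite sqrtr_sqr ger0_norm// mulr_ge0// ltW.
set S := (X in X <= _).
have hS : eta * S - T%:R * ((eta * M) ^+ 2 / 2) <= ln n%:R + eta * L T i.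
  pose m t := eta * (\sum_j softmax eta (L t.-1) j * (L t j - L t.-1 j))
              - (eta * M) ^+ 2 / 2.
  have -> : eta * S - T%:R * ((eta * M) ^+ 2 / 2) = \sum_(1 <= t < T.+1) m t.
    by rewrite /m sumrB -mulr_sumr sumr_const_nat subn1/= mulr_natl.
  apply: exp_weights_regret => // t tT; rewrite /m/= opprB addrC.
  have := @hoeffding_weighted R n (softmax eta (L t)) (fun j => L t.+1 j - L t j)
            M (- eta) M0 (softmax_ge0 eta (L t)) (sum_softmax eta (L t) i)
            (fun j => LM t j tT).
  rewrite !mulNr sqrrN; apply: le_trans; rewrite le_eqVlt; apply/predU1l.
  by apply: eq_bigr => j _; rewrite mulNr.
(* For a = 0 the rate vanishes and cannot be divided out. Then n = 1, the only weight is 1, and the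
   sum telescopes. *)
have [a_eq0|a_neq0] := eqVneq a 0.
  have n1E : n = 1%N.
    apply/eqP; rewrite -(@eqr_nat R) -ln_eq0 ?(lt_le_trans ltr01 n1)//.
    by rewrite lnE a_eq0 expr0n/= mulr0 mul0r.
  rewrite a_eq0 !mulr0 addr0 {hS}/S; clearbody eta; clear a a0 a2 a_eq0 lnE.
  subst n; rewrite le_eqVlt; apply/predU1l.
  have -> : L T i = \sum_(1 <= t < T.+1) (L t i - L t.-1 i).
    by rewrite big_add1/= telescope_sumr// L0 subr0.
  apply: eq_bigr => t _; rewrite big_ord1.
  have := sum_softmax eta (L t.-1) i; rewrite big_ord1 => ->.
  by rewrite mul1r (ord1 i).
have a_gt0 : 0 < a by rewrite lt_neqAle eq_sym a_neq0.
have eta0 : 0 < eta by rewrite divr_gt0.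
rewrite -(ler_pM2l eta0).
have etaM : eta * M = a by rewrite /eta mulfVK// gt_eqF.
rewrite mulrDr mulrA etaM; move: hS; rewrite lnE etaM.
lra.
Qed.

(** * Covering numbers and the entropy integral *)

Section nets.
Context {R : realType} {X : Type}.
Implicit Types (F : set (X -> R)) (e c : R) (f : X -> R).

Lemma supnorm_le f c x : (supnorm f <= c%:E)%E -> `|f x| <= c.
Proof.
by move=> fc; rewrite -lee_fin (le_trans _ fc)//; apply: ereal_sup_ubound; exists x.
Qed.

Lemma has_net_le F e c n : e <= c -> has_net F e n -> has_net F c n.
Proof.
move=> ec [h [hF hnet]]; exists h; split => // f /hnet[i hi]; exists i.
by rewrite (le_trans hi)// lee_fin.
Qed.

Lemma covnumP F e : (exists n, has_net F e n) ->
  has_net F e (covnum F e) /\ forall n, has_net F e n -> (covnum F e <= n)%N.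
Proof.
rewrite /covnum; case: pselect => // H _; case: ex_minnP => m /asboolP Hm mmin.
by split => // n Hn; apply: mmin; apply/asboolP.
Qed.

Lemma covnum_le F e c : totally_bounded F -> 0 < e -> e <= c ->
  (covnum F c <= covnum F e)%N.
Proof.
move=> tbF e0 ec.
have [netE _] := covnumP F e (tbF _ e0).
have [_] := covnumP F c (tbF _ (lt_le_trans e0 ec)); apply.
exact: has_net_le netE.
Qed.

Lemma covnum_gt0 F e f : totally_bounded F -> 0 < e -> F f -> (0 < covnum F e)%N.
Proof.
move=> tbF e0 Ff; have [[h [_ /(_ f Ff)[i _]]] _] := covnumP F e (tbF _ e0).
by case: (covnum F e) i => [[]|].
Qed.

End nets.

(** Serves to bound [Nk k]: each increment is a difference of elements of two consecutive nets, so
    the pairs are at least as many as the increments. *)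
Lemma leq_mul_of_factorization (Y : Type) (n a b : nat) (g : 'I_n -> Y)
    (h : 'I_a -> 'I_b -> Y) :
  injective g -> (forall i, exists p q, g i = h p q) -> (n <= a * b)%N.
Proof.
move=> ginj gh.
have /choice[s sP] : forall i, exists pq : 'I_a * 'I_b, g i = h pq.1 pq.2.
  by move=> i; have [p [q gi]] := gh i; exists (p, q).
have sinj : injective s by move=> i i' ss; apply: ginj; rewrite !sP ss.
by have := leq_card s sinj; rewrite card_prod !card_ord.
Qed.

(** The preimage of each ray [r, +oo) is an interval. *)
Lemma nonincreasing_in_measurable (R : realType) (D : set R) (f : R -> R) :
  is_interval D -> {in D &, nonincreasing_fun f} -> measurable_fun D f.
Proof.
move=> iD f_ni.
apply: (measurability (@RGenCInfty.G R)) => [|/= _ [_] [r] -> <-].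
  exact: RGenCInfty.measurableE.
apply: is_interval_measurable => s t/= [Ds +] [Dt +].
rewrite !in_itv/= !andbT => fs ft u /andP[su ut].
have Du : D u by apply: (iD s t) => //; rewrite su.
by split=> //; rewrite in_itv/= andbT (le_trans ft)// f_ni ?inE.
Qed.

(** The interval from gamma / 2^(k+1) to gamma / 2^k has length gamma / 2^(k+1), and on it [phi] is
    at least its value at the right end. Monotonicity is asked only away from 0, where [covnum] may
    drop to its default value 0. *)
Lemma dyadic_sum_le_integral (R : realType) (gamma : R) (phi : R -> R) (K : nat) :
  0 < gamma -> (forall x, 0 <= phi x) ->
  {in `]0, gamma / 2] &, nonincreasing_fun phi} ->
  ((\sum_(1 <= k < K.+1) gamma / 2 ^+ k.+1 * phi (gamma / 2 ^+ k))%:E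
    <= \int[lebesgue_measure]_(x in `[0%R, (gamma / 2)%R]) (phi x)%:E)%E.
Proof.
move=> g0 phi0 phi_ni.
have p2 k : 0 < 2 ^+ k :> R by rewrite exprn_gt0.
have g2 k : 0 < gamma / 2 ^+ k by rewrite divr_gt0.
have g2S k : gamma / 2 ^+ k.+1 <= gamma / 2 ^+ k.
  by rewrite ler_pM2l// lef_pV2 ?posrE// exprS ler_peMl ?ler1n// ltW.
have g2le k : gamma / 2 ^+ k.+1 <= gamma / 2.
  by elim: k => [|k IH]; [rewrite expr1|exact: le_trans (g2S _) IH].
have mphi : measurable_fun `]0, gamma / 2] phi.
  apply: nonincreasing_in_measurable => [|x y]; first exact: interval_is_interval.
  by rewrite !inE; exact: phi_ni.
have mphik a b : 0 <= a -> b <= gamma / 2 ->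
    measurable_fun `]a, b] (fun x => (phi x)%:E).
  move=> a0 b2; apply/measurable_EFinP; apply: measurable_funS mphi => //.
  by apply: subset_itv; rewrite bnd_simp.
apply: (@le_trans _ _
    (\int[lebesgue_measure]_(x in `](gamma / 2 ^+ K.+1)%R, (gamma / 2)%R]) (phi x)%:E)%E);
    last first.
  apply: ge0_subset_integral => //.
  - apply/measurable_EFinP.
    by apply/measurable_fun_itv_obnd_cbndP.
  - by move=> x _; rewrite lee_fin.
  - by apply: subset_itv; rewrite bnd_simp// ltW.
(* Raising [K] by one adds the next dyadic interval on the left. *)
elim: K => [|K IH].
  by rewrite big_geq//; apply: integral_ge0 => x _; rewrite lee_fin.
rewrite big_nat_recr//= EFinD.
rewrite (@itv_bndbnd_setU _ _ _ (BRight (gamma / 2 ^+ K.+1))) ?bnd_simp//.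
rewrite ge0_integral_setU//=; last first.
- apply/disj_setPS => x /= []; rewrite !in_itv/= => /andP[_ h1] /andP[h2 _].
  by move: (lt_le_trans h2 h1); rewrite ltxx.
- by move=> x _; rewrite lee_fin.
- rewrite -itv_bndbnd_setU ?bnd_simp//.
  by apply: mphik => //; rewrite ltW.
rewrite addeC leeD//.
have -> : ((gamma / 2 ^+ K.+2 * phi (gamma / 2 ^+ K.+1))%:E =
   \int[lebesgue_measure]_(x in `](gamma / 2 ^+ K.+2)%R, (gamma / 2 ^+ K.+1)%R])
      (cst (phi (gamma / 2 ^+ K.+1))%:E x))%E.
  rewrite integral_cst//= lebesgue_measure_itv/= lte_fin.
  have gap : gamma / 2 ^+ K.+1 - gamma / 2 ^+ K.+2 = gamma / 2 ^+ K.+2.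
    by rewrite [2 ^+ K.+2]exprS; field; rewrite gt_eqF.
  by rewrite -subr_gt0 gap g2 -EFinB gap -EFinM mulrC.
apply: ge0_le_integral => //.
- by move=> x _; rewrite lee_fin.
- by apply: mphik; [exact: ltW (g2 _)|exact: g2le].
- move=> x /=; rewrite in_itv/= => /andP[x1 x2]; rewrite lee_fin.
  apply: phi_ni => //; rewrite in_itv/= ?g2 ?g2le//.
  by rewrite (lt_trans _ x1)// (le_trans x2).
Qed.

(** * Regret of the forecaster against a chain of increments *)

Section forecaster.
Context {R : realType} {X : Type}.
Context (B gamma : R) (T N0 : nat) (f0 : 'I_N0 -> X -> R) (Nk : nat -> nat)
  (g : forall k, 'I_(Nk k) -> X -> R) (K : nat) (eta : nat -> R)
  (xs : nat -> X) (ys : nat -> R).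
Hypotheses (B_gt0 : 0 < B) (gamma_gt0 : 0 < gamma) (gamma_le : gamma <= B)
  (T_ge1 : (1 <= T)%N)
  (ys_le : forall t, (1 <= t <= T)%N -> `|ys t| <= B)
  (f0_le : forall j x, `|f0 j x| <= B)
  (Nk_gt0 : forall k, (1 <= k)%N -> (0 < Nk k)%N)
  (g_le : forall k i x, (1 <= k)%N -> `|g k i x| <= 3 * (gamma / 2 ^+ k)).

Local Notation fhat := (fhat N0 f0 Nk g K eta xs ys).
Local Notation cumU := (cumU N0 f0 Nk g K eta xs ys).
Local Notation yhat := (yhat N0 f0 Nk g K (1 / (50 * B ^+ 2)) eta xs ys).
Local Notation cumW := (cumW N0 f0 Nk g K eta xs ys).

(** Level k averages its increments, so it contributes at most 3 gamma / 2^k. The geometric series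
    adds at most 3 gamma <= 3 B to the bound B of [f0]. *)
Lemma fhat_le t j x : `|fhat t j x| <= 4 * B.
Proof.
have geom : \sum_(1 <= k < K.+1) 3 * (gamma / 2 ^+ k) = 3 * (gamma - gamma / 2 ^+ K).
  elim: K => [|k IH]; first by rewrite big_geq// expr0; field.
  rewrite big_nat_recr//= IH exprS; field.
  by rewrite expf_neq0// pnatr_eq0.
have gK : 0 <= gamma / 2 ^+ K by rewrite divr_ge0 ?exprn_ge0// ltW.
apply: (@le_trans _ _ (B + \sum_(1 <= k < K.+1) 3 * (gamma / 2 ^+ k))); last first.
  by rewrite geom; move: gK gamma_le; set c := _ / _; lra.
rewrite /fhat /fhat_of (le_trans (ler_normD _ _))// lerD//.
apply: (le_trans (ler_norm_sum _ _ _)); rewrite !big_nat; apply: ler_sum => k /andP[k1 _].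
apply: (le_trans (ler_norm_sum _ _ _)); set c := 3 * _; rewrite -[c]mul1r.
rewrite -(sum_softmax (eta k) (cumU t.-1 j k) (Ordinal (Nk_gt0 k k1))) mulr_suml.
apply: ler_sum => i _; rewrite normrM (ger0_norm (softmax_ge0 _ _ _)).
by apply: ler_wpM2l; [exact: softmax_ge0|exact: g_le].
Qed.

Lemma residual_le t j x : (1 <= t <= T)%N -> `|ys t - fhat t j x| <= 5 * B.
Proof.
move=> /ys_le hy; rewrite (le_trans (ler_normB _ _))//.
by have := fhat_le t j x; lra.
Qed.

(** The rate is 1 / (2 D^2) for the residual bound D = 5 B, so exp-concavity is exactly the
    one-round hypothesis of [exp_weights_regret]. *)
Lemma yhat_regret (j : 'I_N0) :
  \sum_(1 <= t < T.+1) (ys t - yhat t) ^+ 2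
    <= \sum_(1 <= t < T.+1) (ys t - fhat t j (xs t)) ^+ 2
       + 50 * B ^+ 2 * ln N0%:R.
Proof.
set eta0 := 1 / (50 * B ^+ 2).
have eta0_gt0 : 0 < eta0 by rewrite divr_gt0// mulr_gt0// exprn_gt0.
have D_gt0 : 0 < 5 * B by rewrite mulr_gt0.
have eta0E : eta0 = 1 / (2 * (5 * B) ^+ 2).
  by rewrite /eta0; congr (_ / _); ring.
have : \sum_(1 <= t < T.+1) eta0 * (ys t - yhat t) ^+ 2
    <= ln N0%:R + eta0 * cumW T j.
  apply: exp_weights_regret => [i|t tT]; first by rewrite /Defs.cumW big_geq.
  have tT' : (1 <= t.+1 <= T)%N by rewrite tT.
  have := @expR_sqr_concave R N0 (softmax eta0 (cumW t))
    (fun i => fhat t.+1 i (xs t.+1)) (5 * B) (ys t.+1) D_gt0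
    (softmax_ge0 eta0 (cumW t)) (sum_softmax eta0 (cumW t) j)
    (fun i => residual_le t.+1 i (xs t.+1) tT').
  rewrite -eta0E; apply: le_trans.
  rewrite le_eqVlt; apply/predU1l; apply: eq_bigr => i _; congr (_ * expR (- (_ * _))).
  by rewrite /Defs.cumW [in LHS]big_nat_recr//= addrAC subrr add0r.
rewrite -mulr_sumr => regret; rewrite -(ler_pM2l eta0_gt0) mulrDr.
have -> : eta0 * (50 * B ^+ 2 * ln N0%:R) = ln N0%:R.
  by rewrite /eta0; field; rewrite gt_eqF.
by rewrite [leRHS]addrC.
Qed.

Hypothesis etaE : forall k,
  eta k = Num.sqrt (2 * ln (Nk k)%:R / T%:R) * 2 ^+ k / (30 * B * gamma).

(** The linearized losses are at most 2 (5 B) (3 gamma / 2^k) = [M], and [eta k] is the Hoeffding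
    rate for this [M]. *)
Lemma level_regret j k (i : 'I_(Nk k)) : (1 <= k)%N ->
  \sum_(1 <= t < T.+1) \sum_i' uhat N0 f0 Nk g K eta xs ys t j k i' *
      (- 2 * (ys t - fhat t j (xs t)) * g k i' (xs t))
    <= \sum_(1 <= t < T.+1) - 2 * (ys t - fhat t j (xs t)) * g k i (xs t)
       + 30 * B * (gamma / 2 ^+ k) * Num.sqrt (2 * T%:R * ln (Nk k)%:R).
Proof.
move=> k1; set M := 30 * B * (gamma / 2 ^+ k).
have p2 : 0 < 2 ^+ k :> R by rewrite exprn_gt0.
have M_gt0 : 0 < M by rewrite !mulr_gt0// invr_gt0.
have cumUE n : \sum_(1 <= t < n.+1) - 2 * (ys t - fhat t j (xs t)) * g k i (xs t)
    = cumU n j k i.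
  by elim: n => [|n IH]; [rewrite big_geq|rewrite big_nat_recr//= IH].
rewrite cumUE.
have := @exp_weights_hoeffding R (Nk k) (fun t => cumU t j k) M T i M_gt0 T_ge1.
have -> : Num.sqrt (2 * ln (Nk k)%:R / T%:R) / M = eta k.
  rewrite etaE /M; field.
  by rewrite !gt_eqF.
move=> /(_ (fun=> erefl)) regret.
have /regret : forall t i', (t < T)%N -> `|cumU t.+1 j k i' - cumU t j k i'| <= M.
  move=> t i' tT; rewrite /= addrAC subrr add0r -/(fhat t.+1 j).
  rewrite !normrM normrN normr_nat.
  have /(residual_le t.+1 j (xs t.+1)) h1 : (1 <= t.+1 <= T)%N by rewrite tT.
  have h2 := g_le k i' (xs t.+1) k1.
  have -> : M = (2 * (5 * B)) * (3 * (gamma / 2 ^+ k)) by rewrite /M; ring.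
  by apply: ler_pM => //; rewrite ?ler_wpM2l ?mulr_ge0.
apply: le_trans; rewrite le_eqVlt; apply/predU1l; rewrite !big_nat; apply: eq_bigr => t /andP[t1 _].
apply: eq_bigr => i' _; congr (_ * _).
(* Rounds start at 1, so [t.-1] is a genuine predecessor. *)
by case: t t1 => // t _; rewrite /= addrAC subrr add0r.
Qed.

(** The square loss lies above its tangent at the prediction of expert [j]. That prediction and the
    comparator share the base [f0 j], so the linear term splits over the levels. *)
Lemma fhat_regret j (h : nat -> X -> R) :
  (forall k, (1 <= k)%N -> exists i, h k = g k i) ->
  \sum_(1 <= t < T.+1) (ys t - fhat t j (xs t)) ^+ 2
    <= \sum_(1 <= t < T.+1)
         (ys t - (f0 j (xs t) + \sum_(1 <= k < K.+1) h k (xs t))) ^+ 2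
       + \sum_(1 <= k < K.+1)
           30 * B * (gamma / 2 ^+ k) * Num.sqrt (2 * T%:R * ln (Nk k)%:R).
Proof.
move=> hg.
pose u t k := \sum_i uhat N0 f0 Nk g K eta xs ys t j k i * g k i (xs t).
pose r t := - 2 * (ys t - fhat t j (xs t)).
have convex t : (ys t - fhat t j (xs t)) ^+ 2 <=
    (ys t - (f0 j (xs t) + \sum_(1 <= k < K.+1) h k (xs t))) ^+ 2
    + \sum_(1 <= k < K.+1) r t * (u t k - h k (xs t)).
  rewrite -mulr_sumr sumrB.
  have -> : \sum_(1 <= k < K.+1) u t k = fhat t j (xs t) - f0 j (xs t).
    by rewrite /Defs.fhat /fhat_of addrAC subrr add0r.
  rewrite /r; set a := fhat _ _ _; set b := \sum_(_ <= _ < _) _; set c := f0 _ _.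
  (* The gap between the two sides is the square of the difference of the two predictions. *)
  rewrite -subr_ge0; have := sqr_ge0 (a - (c + b)); congr (0 <= _); ring.
apply: (le_trans (ler_sum _ (fun t _ => convex t))).
rewrite big_split/= lerD2l exchange_big/= !big_nat; apply: ler_sum => k /andP[k1 _].
have [i hi] := hg k k1.
under eq_bigr do rewrite mulrBr.
rewrite sumrB lerBlDl.
have := level_regret j k i k1; rewrite -hi; congr (_ <= _).
by apply: eq_bigr => t _; rewrite mulr_sumr; apply: eq_bigr => i' _; rewrite mulrCA.
Qed.

End forecaster.

(** * Comparison with arbitrary functions of the class, and the final bound *)

Lemma sqr_loss_perturb (R : realType) (B d y a b : R) :
  `|y| <= B -> `|a| <= B -> `|b| <= B -> `|a - b| <= d ->
  (y - b) ^+ 2 <= (y - a) ^+ 2 + 4 * B * d.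
Proof.
move=> hy ha hb hab.
have -> : (y - b) ^+ 2 = (y - a) ^+ 2 + (a - b) * (2 * y - a - b) by ring.
rewrite lerD2l (le_trans (ler_norm _))// normrM mulrC ler_pM//.
by move: hy ha hb; rewrite !ler_norml => /andP[? ?] /andP[? ?] /andP[? ?]; lra.
Qed.

(** The ceiling gives gamma T / B <= 2^K. As gamma T / B > 1, the logarithm is positive and [absz]
    leaves the ceiling unchanged. *)
Lemma chaining_levels_ge (R : realType) (B gamma : R) (T : nat) :
  0 < B -> (1 <= T)%N -> B / T%:R < gamma ->
  gamma / 2 ^+ absz (Num.ceil (ln (gamma * T%:R / B) / ln 2)) <= B / T%:R.
Proof.
move=> B0 T1 hg; have T0 : 0 < T%:R :> R by rewrite ltr0n.
set r := gamma * T%:R / B.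
have r1 : 1 < r by rewrite /r ltr_pdivlMr// mul1r -ltr_pdivrMr.
have l2 : 0 < ln 2 :> R by rewrite ln_gt0// ltr1n.
set K := absz _.
have KE : (Num.ceil (ln r / ln 2))%:~R = K%:R :> R.
  rewrite [RHS]pmulrn gez0_abs// ceil_ge0.
  by apply: lt_le_trans (_ : 0 <= _); rewrite ?ltrN10// divr_ge0// ltW// ln_gt0.
have p2 : 0 < 2 ^+ K :> R by rewrite exprn_gt0.
have r_le : r <= 2 ^+ K.
  rewrite -ler_ln ?posrE ?(lt_trans ltr01 r1)// lnXn// -[leRHS]mulr_natl -ler_pdivrMr//.
  by rewrite -KE ceil_ge.
rewrite ler_pdivrMr// mulrAC ler_pdivlMr//.
by move: r_le; rewrite /r ler_pdivrMr// [leRHS]mulrC.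
Qed.

(** Injectivity of [g k] makes [Nk k] the cardinality of G^(k). Extended reals accommodate an empty
    [F], whose infimum is +oo, and a divergent entropy integral. *)
Theorem theorem2 (R : realType) (X : Type) (B gamma : R) (T : nat)
  (F : set (X -> R)) (xs : nat -> X) (ys : nat -> R)
  (net : forall k : nat, 'I_(covnum F (gamma / 2 ^+ k)) -> X -> R)
  (pi : nat -> (X -> R) -> (X -> R))
  (Nk : nat -> nat) (g : forall k : nat, 'I_(Nk k) -> X -> R) :
  0 < B -> (1 <= T)%N -> B / T%:R < gamma -> gamma < B ->
  (forall f, F f -> (supnorm f <= B%:E)%E) ->
  totally_bounded F ->
  (forall t, (1 <= t <= T)%N -> `|ys t| <= B) ->
  (forall k, is_proper_net F (gamma / 2 ^+ k) (net k) /\ injective (net k)) ->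
  (forall k f, F f ->
     (exists i, pi k f = net k i) /\
     (forall i, (supnorm (fun x => (f x - pi k f x)%R)
                 <= supnorm (fun x => (f x - net k i x)%R))%E)) ->
  (forall k, (1 <= k)%N ->
     injective (g k) /\
     range (g k) = [set (fun x => pi k f x - pi k.-1 f x) | f in F]) ->
  let K := absz (Num.ceil (ln (gamma * T%:R / B) / ln 2)) in
  let eta0 := 1 / (50 * B ^+ 2) in
  let eta := fun k : nat =>
    Num.sqrt (2 * ln (Nk k)%:R / T%:R) * 2 ^+ k / (30 * B * gamma) in
  (((\sum_(1 <= t < T.+1) (ys t - yhat _ (net 0%N) Nk g K eta0 eta xs ys t) ^+ 2)%R)%:E
   - ereal_inf [set (\sum_(1 <= t < T.+1) (ys t - f (xs t)) ^+ 2)%R%:E | f in F]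
   <= (B ^+ 2 * (5 + 50 * ln (covnum F gamma)%:R))%R%:E
      + (120 * B * Num.sqrt T%:R)%R%:E
        * \int[lebesgue_measure]_(e in `[0%R, (gamma / 2)%R]%classic)
            (Num.sqrt (ln (covnum F e)%:R))%R%:E)%E.
Proof.
move=> B_gt0 T_ge1 gamma_gt gamma_lt F_le tbF ys_le netP piP gP; cbv zeta.
set K := absz _; set eta := (X in yhat _ _ _ _ _ _ X _ _).
have T_gt0 : 0 < T%:R :> R by rewrite ltr0n.
have gamma_gt0 : 0 < gamma by rewrite (lt_trans _ gamma_gt)// divr_gt0.
have p2 k : 0 < 2 ^+ k :> R by rewrite exprn_gt0.
have g2 k : 0 < gamma / 2 ^+ k by rewrite divr_gt0.
have FB h x : F h -> `|h x| <= B by move=> Fh; exact: supnorm_le (F_le h Fh).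
have piF k f : F f -> F (pi k f).
  by move=> /(piP k)[[i ->] _]; have [[+ _] _] := netP k; apply.
have pi_near k f x : F f -> `|f x - pi k f x| <= gamma / 2 ^+ k.
  move=> Ff; have [[_ /(_ f Ff)[i hi]] _] := netP k.
  have [_ /(_ i) pi_min] := piP k f Ff.
  exact: (supnorm_le (fun x => f x - pi k f x) _ x (le_trans pi_min hi)).
have gE k i : (1 <= k)%N ->
    exists2 f, F f & g k i = (fun x => pi k f x - pi k.-1 f x).
  move=> /gP[_ gr]; have : range (g k) (g k i) by exists i.
  by rewrite gr => -[f Ff <-]; exists f.
have g_le k i x : (1 <= k)%N -> `|g k i x| <= 3 * (gamma / 2 ^+ k).
  move=> k1; have [f Ff ->] := gE k i k1.
  (* Triangle inequality through [f x]: the distances gamma / 2^k and gamma / 2^(k-1) = 2 gamma /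
     2^k add up to 3 gamma / 2^k. *)
  have := pi_near k f x Ff; have := pi_near k.-1 f x Ff.
  have -> : gamma / 2 ^+ k.-1 = 2 * (gamma / 2 ^+ k).
    by rewrite -[k in RHS]prednK// exprS; field; rewrite gt_eqF.
  set a := f x; set b := pi k f x; set c := pi k.-1 f x; set e := gamma / _.
  by rewrite !ler_norml => /andP[? ?] /andP[? ?]; apply/andP; split; lra.
have Nk_le k : (1 <= k)%N ->
    (Nk k <= covnum F (gamma / 2 ^+ k) * covnum F (gamma / 2 ^+ k.-1))%N.
  move=> k1; apply: (@leq_mul_of_factorization _ _ _ _ (g k)
    (fun p q x => net k p x - net k.-1 q x)); first by have [] := gP k k1.
  move=> i; have [f Ff ->] := gE k i k1.
  have [[p ->] _] := piP k f Ff; have [[q ->] _] := piP k.-1 f Ff.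
  by exists p, q.
pose phi e := Num.sqrt (ln (covnum F e)%:R : R).
pose D := \sum_(1 <= k < K.+1) gamma / 2 ^+ k.+1 * phi (gamma / 2 ^+ k).
set A := (X in (X%:E - _)%E).
set I := (\int[_]_(_ in _) _)%E.
(* The bound is proved for each [f] with the finite sum [D]; the integral and the infimum enter only
   at the end. *)
have real_bound f : F f ->
    A <= \sum_(1 <= t < T.+1) (ys t - f (xs t)) ^+ 2
         + B ^+ 2 * (5 + 50 * ln (covnum F gamma)%:R)
         + 120 * B * Num.sqrt T%:R * D.
  move=> Ff.
  have cov_gt0 k : (0 < covnum F (gamma / 2 ^+ k))%N by exact: covnum_gt0 Ff.
  have pi_g k : (1 <= k)%N -> exists i, (fun x => pi k f x - pi k.-1 f x) = g k i.
    move=> /gP[_ gr].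
    have : range (g k) (fun x => pi k f x - pi k.-1 f x) by rewrite gr; exists f.
    by move=> [i _ <-]; exists i.
  have Nk_gt0 k : (1 <= k)%N -> (0 < Nk k)%N.
    by move=> /pi_g[i _]; case: (Nk k) i => [[]|].
  have f0_le j x : `|net 0%N j x| <= B.
    by apply: FB; have [[+ _] _] := netP 0%N; apply.
  (* The competing expert [j] starts from [pi 0 f]; adding the increments of [f] telescopes to
     [pi K f]. *)
  have [[j jE] _] := piP 0%N f Ff.
  have yr := yhat_regret B gamma T _ (net 0%N) Nk g K eta xs ys B_gt0 gamma_gt0
    (ltW gamma_lt) ys_le f0_le Nk_gt0 g_le j.
  have fr := fhat_regret B gamma T _ (net 0%N) Nk g K eta xs ys B_gt0 gamma_gt0
    (ltW gamma_lt) T_ge1 ys_le f0_le Nk_gt0 g_le (fun=> erefl) j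
    (fun k x => pi k f x - pi k.-1 f x) pi_g.
  have N0E : covnum F (gamma / 2 ^+ 0) = covnum F gamma by rewrite expr0 divr1.
  have approx : \sum_(1 <= t < T.+1) (ys t - (net 0%N j (xs t) +
        \sum_(1 <= k < K.+1) (pi k f (xs t) - pi k.-1 f (xs t)))) ^+ 2
      <= \sum_(1 <= t < T.+1) (ys t - f (xs t)) ^+ 2 + 4 * B ^+ 2.
    have -> : 4 * B ^+ 2 = \sum_(1 <= t < T.+1) 4 * B * (B / T%:R).
      rewrite sumr_const_nat subn1/= -mulr_natr; field.
      by rewrite gt_eqF.
    rewrite -big_split/= !big_nat; apply: ler_sum => t tT.
    have -> : net 0%N j (xs t) +
        \sum_(1 <= k < K.+1) (pi k f (xs t) - pi k.-1 f (xs t)) = pi K f (xs t).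
      by rewrite big_add1/= (telescope_sumr (fun k => pi k f (xs t)))// jE addrC subrK.
    apply: sqr_loss_perturb; [exact: ys_le|exact: FB|exact/FB/piF|].
    by apply: le_trans (pi_near K f (xs t) Ff) _; exact: chaining_levels_ge.
  (* From ln N_k <= 2 ln N(gamma / 2^k), the square root is at most 2 sqrt T times [phi], and 30 * 2
     * gamma / 2^k = 120 * gamma / 2^(k+1). *)
  have levels : \sum_(1 <= k < K.+1)
        30 * B * (gamma / 2 ^+ k) * Num.sqrt (2 * T%:R * ln (Nk k)%:R)
      <= 120 * B * Num.sqrt T%:R * D.
    rewrite mulr_sumr !big_nat; apply: ler_sum => k /andP[k1 _].
    have lnNk : ln (Nk k)%:R <= 2 * ln (covnum F (gamma / 2 ^+ k))%:R :> R.
      rewrite mulr_natl -lnXn ?ltr0n// ler_ln ?posrE ?exprn_gt0 ?ltr0n ?Nk_gt0//.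
      rewrite -natrX ler_nat expnS expn1 (leq_trans (Nk_le k k1))// leq_mul2l.
      apply/orP; right; apply: covnum_le => //.
      rewrite ler_pM2l// lef_pV2 ?posrE// -[k in leRHS]prednK// exprS.
      by rewrite ler_peMl ?ler1n// ltW.
    have sqrt_le : Num.sqrt (2 * T%:R * ln (Nk k)%:R)
        <= 2 * (Num.sqrt T%:R * phi (gamma / 2 ^+ k)) :> R.
      have -> : 2 * (Num.sqrt T%:R * phi (gamma / 2 ^+ k))
          = Num.sqrt (2 ^+ 2 * (T%:R * ln (covnum F (gamma / 2 ^+ k))%:R)) :> R.
        by rewrite sqrtrM ?sqrtr_sqr ?ger0_norm// sqrtrM ?ler0n.
      by rewrite ler_wsqrtr//; nra.
    have -> : 120 * B * Num.sqrt T%:R * (gamma / 2 ^+ k.+1 * phi (gamma / 2 ^+ k))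
        = 30 * B * (gamma / 2 ^+ k) * (2 * (Num.sqrt T%:R * phi (gamma / 2 ^+ k))).
      by rewrite exprS; field; rewrite gt_eqF.
    by rewrite ler_wpM2l// !mulr_ge0// ltW// invr_gt0.
  rewrite [X in ln X%:R]N0E in yr.
  (* The approximation cost 4 B^2 is absorbed in 5 B^2. *)
  have B2 : 0 <= B ^+ 2 by exact: sqr_ge0.
  rewrite /A; lra.
have DI : (D%:E <= I)%E.
  apply: dyadic_sum_le_integral => // [x|x y]; first exact: sqrtr_ge0.
  rewrite !in_itv/= => /andP[x0 _] /andP[y0 _] xy; rewrite ler_wsqrtr//.
  have := covnum_le F x y tbF x0 xy.
  (* If [F] is empty the covering number is 0, where [ln] takes the value 0. *)
  have [->|cy] := posnP (covnum F y).
    move=> _; rewrite [leLHS]ln0//.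
    by case: (covnum F x) => [|n]; [rewrite ln0|rewrite ln_ge0 ?ler1n].
  by move=> cxy; rewrite ler_ln ?posrE ?ltr0n ?ler_nat// (leq_trans cy).
have I0 : (0 <= I)%E by apply: integral_ge0 => x _; rewrite lee_fin sqrtr_ge0.
have d_gt0 : 0 < 120 * B * Num.sqrt T%:R by rewrite !mulr_gt0// sqrtr_gt0.
(* An infinite integral makes the right side +oo, since its coefficient is positive. *)
move: DI I0; case: I => [r| |]//; last first.
  by move=> _ _; rewrite gt0_muley ?lte_fin// addey// leey.
rewrite lee_fin => Dr _; rewrite -EFinM -EFinD lee_subel_addr// -leeBlDl// -EFinB.
apply: le_ereal_inf_tmp => _ [f Ff <-]; rewrite lee_fin.
have := real_bound f Ff; have := ler_wpM2l (ltW d_gt0) Dr; lra.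
Qed.
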